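(* Let $(X,\preceq)$ be a pre-order set, let $x_0\in X$ be such that $S(x_0)\neq\emptyset$, and let $\eta:(X,\preceq)\to\mathbb{R}\cup\{\pm\infty\}$ be an extended real-valued function which is monotone with respect to $\preceq$. Suppose that the following conditions are satisfied: (A) $-\infty<\inf\{\eta(x): x\in S(x_0)\}<+\infty$. (B) For any $x\in S(x_0)$ with $-\infty<\eta(x)<+\infty$ and any $z_1,z_2\in S(x)$ with $z_1\neq z_2$, one has $\eta(x)>\min\{\eta(z_1),\eta(z_2)\}$. (C) For any sequence $(x_n)_{n\ge 1}\subset S(x_0)$ with $x_n\in S(x_{n-1})$ for all $n\ge 1$, such that $\eta(x_n)-\inf\{\eta(x): x\in S(x_{n-1})\}\to 0$ as $n\to\infty$, there exists $u\in X$ such that $u\in S(x_n)$ for all $n$. Then there exists $\hat{x}\in X$ such that (a) $\hat{x}\in S(x_0)$; (b) $S(\hat{x})\subset\{\hat{x}\}$.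
   Context: A pre-order on a nonempty set $X$ is a binary relation $\preceq$ on $X$ satisfying only the transitive property (reflexivity is NOT assumed). A pre-order set $(X,\preceq)$ is a nonempty set with such a relation. For $x\in X$, $S(x):=\{z\in X: z\preceq x\}$ (possibly empty). A function $\eta:X\to\mathbb{R}\cup\{\pm\infty\}$ is monotone with respect to $\preceq$ if $x_1\preceq x_2$ implies $\eta(x_1)\le\eta(x_2)$. *)

(* Defs.v *)
From HB Require Import structures.
From mathcomp Require Import all_boot all_order all_algebra.
From mathcomp Require Import all_classical all_reals all_analysis.
Set Implicit Arguments.
Unset Strict Implicit.
Unset Printing Implicit Defensive.
Import Order.TTheory GRing.Theory Num.Theory.
Local Open Scope classical_set_scope.
Local Open Scope ereal_scope.

(* "Pre-order" here means a merely transitive relation: reflexivity is not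
   assumed, so that [down_set le x] may be empty or may omit [x]. *)
Definition preorder_rel (X : Type) (le : X -> X -> Prop) : Prop :=
  forall x y z : X, le x y -> le y z -> le x z.

Definition down_set (X : Type) (le : X -> X -> Prop) (x : X) : set X :=
  [set z | le z x].

Definition monotone_for (R : realType) (X : Type) (le : X -> X -> Prop)
    (eta : X -> \bar R) : Prop :=
  forall x1 x2 : X, le x1 x2 -> eta x1 <= eta x2.

(* Main.v *)
(* Assume no point of S(x0) is as wanted, so that S(x) is nonempty for every x in
   S(x0).  Starting from x0, choose x_(n+1) in S(x_n) with
   eta x_(n+1) < inf eta(S(x_n)) + 1/(n+1), and let u be a common lower bound of
   the x_n, as given by (C).  Any w below u lies in every S(x_n), so
   eta u <= eta x_(n+1) <= eta w + 1/(n+1) for all n: eta is bounded below by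
   eta u on S(u).  But S(u) contains some v, and S(v) some w <> v, and (B) at u
   forces eta v or eta w to be smaller than eta u. *)

Require Import Defs.
From HB Require Import structures.
From mathcomp Require Import all_boot all_order all_algebra.
From mathcomp Require Import all_classical all_reals all_analysis.
Import Order.TTheory GRing.Theory Num.Theory.
Local Open Scope classical_set_scope.
Local Open Scope ereal_scope.

Lemma down_set_sub {X : Type} {le : X -> X -> Prop} {x y : X} :
  preorder_rel le -> le x y -> down_set le x `<=` down_set le y.
Proof. by move=> tr xy z zx; exact: tr xy. Qed.

(** [harmonic n] is 1/(n+1), which eventually drops below any positive [e]. *)
Lemma lee_add_harmonic (R : realType) (a b : \bar R) :
  (forall n, a <= b + (harmonic n)%:E) -> a <= b.
Proof.
move=> ab; apply/lee_addgt0Pr => e e0.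
near \oo => n.
apply: (le_trans (ab n)); rewrite leeD2l// lee_fin ltW//.
near: n; exact: (cvgr_lt _ cvg_harmonic).
Unshelve. all: by end_near. Qed.

(** Making [next] total, with finiteness as a premise, lets the sequence be built by plain recursion
    before any infimum is known to be finite. *)
Lemma near_minimizing_choice (R : realType) (X : Type) (le : X -> X -> Prop)
    (eta : X -> \bar R) :
  exists next : nat -> X -> X, forall n x,
    ereal_inf (eta @` down_set le x) \is a fin_num ->
    le (next n x) x /\
    eta (next n x) < ereal_inf (eta @` down_set le x) + (harmonic n)%:E.
Proof.
have near_min (p : nat * X) : exists y,
    ereal_inf (eta @` down_set le p.2) \is a fin_num ->
    le y p.2 /\
    eta y < ereal_inf (eta @` down_set le p.2) + (harmonic p.1)%:E.
  have [fin|_] := boolP (ereal_inf (eta @` down_set le p.2) \is a fin_num).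
    have [_ [y yx <-] yinf] := lb_ereal_inf_adherent (harmonic_gt0 p.1) fin.
    by exists y.
  (* Dummy value: the premise fails here. *)
  by exists p.2.
have [f fP] := choice near_min.
by exists (fun n x => f (n, x)) => n x; exact: (fP (n, x)).
Qed.

Theorem theorem2p1 (R : realType) (X : Type) (le : X -> X -> Prop)
    (le_preorder : preorder_rel le) (x0 : X)
    (S_x0 : down_set le x0 !=set0)
    (eta : X -> \bar R) (eta_monotone : monotone_for le eta)
    (condA : -oo < ereal_inf [set eta x | x in down_set le x0] < +oo)
    (condB : forall x : X, down_set le x0 x -> -oo < eta x < +oo ->
       forall z1 z2 : X, down_set le x z1 -> down_set le x z2 -> z1 <> z2 ->
         Order.min (eta z1) (eta z2) < eta x)
    (condC : forall x_ : nat -> X, x_ 0%N = x0 ->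
       (forall n : nat, (1 <= n)%N -> down_set le x0 (x_ n)) ->
       (forall n : nat, (1 <= n)%N -> down_set le (x_ n.-1) (x_ n)) ->
       (fun n : nat =>
          eta (x_ n) - ereal_inf [set eta x | x in down_set le (x_ n.-1)])
         @ \oo --> (0 : \bar R) ->
       exists u : X, forall n : nat, (1 <= n)%N -> down_set le (x_ n) u) :
  exists xhat : X,
    down_set le x0 xhat /\ down_set le xhat `<=` [set xhat].
Proof.
apply: contrapT => none.
have below x : down_set le x0 x -> exists2 z, le z x & z <> x.
  move=> x0x; apply: contrapT => nz; apply: none; exists x; split => // z zx.
  by apply: contrapT => zNx; apply: nz; exists z.
have [lbS ltS] := andP condA.
have gtNy x : down_set le x0 x -> -oo < eta x.
  by move=> x0x; apply: lt_le_trans lbS _; apply: ereal_inf_lbound; exists x.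
(* Passing to the smaller set S(x) keeps the lower bound of (A); a point of S(x) and monotonicity
   cap the infimum by [eta x]. *)
have fin_inf x : down_set le x0 x -> eta x < +oo ->
    ereal_inf (eta @` down_set le x) \is a fin_num.
  move=> x0x xy; rewrite fin_numElt; apply/andP; split.
    apply: lt_le_trans lbS _; apply: ereal_inf_le_tmp.
    exact: image_subset (down_set_sub le_preorder x0x).
  have [z zx _] := below x x0x.
  apply: le_lt_trans xy; apply: (@le_trans _ _ (eta z)); last exact: eta_monotone.
  by apply: ereal_inf_lbound; exists z.
have [next nextP] := near_minimizing_choice _ _ le eta.
pose x_ := fix x_ n := if n is m.+1 then next m (x_ m) else x0.
(* A value strictly below some extended real cannot be [+oo]. *)
have finite_next n x : (ereal_inf (eta @` down_set le x) \is a fin_num) ->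
    eta (next n x) < +oo.
  move=> fin; apply: lt_le_trans (leey _); apply: lt_le_trans (nextP n x fin).2 _.
  exact: leey.
(* Membership starts at index 1, since [x0] need not lie in S(x0); so the base case takes finiteness
   from (A) and later ones from [fin_inf]. *)
have x_fin n : ereal_inf (eta @` down_set le (x_ n)) \is a fin_num /\
    down_set le x0 (x_ n.+1).
  elim: n => [|n [fin x0n]].
    have fin : ereal_inf (eta @` down_set le x0) \is a fin_num.
      by rewrite fin_numElt.
    by split => //; exact: (nextP 0%N x0 fin).1.
  have fin' : ereal_inf (eta @` down_set le (x_ n.+1)) \is a fin_num.
    exact: fin_inf x0n (finite_next _ _ fin).
  by split => //; exact: le_preorder (nextP _ _ fin').1 x0n.
have x_le n : le (x_ n.+1) (x_ n) by exact: (nextP _ _ (x_fin n).1).1.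
have x_inf n :
    eta (x_ n.+1) < ereal_inf (eta @` down_set le (x_ n)) + (harmonic n)%:E.
  exact: (nextP _ _ (x_fin n).1).2.
have [||||u ux] := condC x_.
- by [].
- by case=> // n _; exact: (x_fin n).2.
- by case=> [|n _] //; exact: x_le.
(* The shift discards index 0, where [n.-1] is again 0; the remaining gaps lie between 0 and
   [harmonic n]. *)
- rewrite -cvg_shiftS /=.
  have harm0 : (harmonic n : R)%:E @[n --> \oo] --> (0 : \bar R).
    by apply: cvg_EFin; [exact: nearW|exact: cvg_harmonic].
  apply: (squeeze_cvge _ (cvg_cst 0) harm0).
  apply: nearW => n; apply/andP; split.
    rewrite sube_ge0 ?(x_fin n).1 ?orbT//.
    by apply: ereal_inf_lbound; exists (x_ n.+1).
  by rewrite leeBlDl ?(x_fin n).1// ltW //; exact: x_inf.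
have x0u : down_set le x0 u by exact: le_preorder (ux 1%N isT) (x_fin 0%N).2.
have u_min w : le w u -> eta u <= eta w.
  move=> wu; apply: lee_add_harmonic => n.
  apply: (le_trans (eta_monotone _ _ (ux n.+1 isT))).
  apply: (le_trans (ltW (x_inf n))); rewrite leeD2r//.
  apply: ereal_inf_lbound; exists w => //.
  exact: le_preorder wu (le_preorder _ _ _ (ux n.+1 isT) (x_le n)).
have uy : eta u < +oo.
  apply: le_lt_trans (eta_monotone _ _ (ux 1%N isT)) _.
  exact: finite_next (x_fin 0%N).1.
have [v vu _] := below u x0u.
have [w wv wNv] := below v (le_preorder _ _ _ vu x0u).
have wu := le_preorder _ _ _ wv vu.
(* (B) needs [eta u] finite: [gtNy] and [uy] give the two bounds. *)
have := condB u x0u _ w v wu vu wNv; rewrite gtNy//= => /(_ uy).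
by rewrite ltNge le_min !u_min.
Qed.
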